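(* If $j:A\to B$ is a cofibration and $p:X\to Y$ is a fibration of partitioned sets, then the induced map $$(j^*,p_* ): \operatorname{Hom}(B,X) \to \operatorname{Hom}(A,X)\times_{\operatorname{Hom}(A,Y)} \operatorname{Hom}(B,Y),\qquad f\mapsto (f\circ j,\ p\circ f),$$ is a fibration of partitioned sets, which is acyclic if $j$ or $p$ is acyclic.
   Context: A partitioned set is a set $X$ with an equivalence relation $\sim$. A morphism $f:X\to Y$ of partitioned sets is a map of sets with $f(x)\sim f(x')$ whenever $x\sim x'$. $\mathcal E$ is the category of partitioned sets and their morphisms. A morphism $f:X\to Y$ is: a cofibration if it is injective; a fibration if it maps each equivalence class of $X$ onto an equivalence class of $Y$; acyclic (a weak equivalence) if the induced map of quotient sets $X/\!\sim\;\to Y/\!\sim$ is a bijection. For partitioned sets $X,Y$, $\operatorname{Hom}(X,Y)$ is the set of morphisms $X\to Y$ with the equivalence relation: $f\sim g$ if $f(x)\sim g(x)$ for all $x\in X$. The fibre product is the pullback in $\mathcal E$, taken along $p_*:\operatorname{Hom}(A,X)\to\operatorname{Hom}(A,Y)$ (postcomposition by $p$) and $j^*:\operatorname{Hom}(B,Y)\to\operatorname{Hom}(A,Y)$ (precomposition by $j$); it is the set-theoretic pullback with $(u,v)\sim(u',v')$ if and only if $u\sim u'$ and $v\sim v'$. *)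

(* Defs.v *)
From Stdlib Require Import RelationClasses.
From mathcomp Require Import all_boot.
From mathcomp Require Import boolp classical_sets.

Set Implicit Arguments.
Unset Strict Implicit.
Unset Printing Implicit Defensive.

Local Open Scope classical_set_scope.

(* Equality in the underlying set is Leibniz equality, not the equivalence
   relation [peq]. *)
Record pset := PSet {
  pcarrier :> Type;
  peq : pcarrier -> pcarrier -> Prop;
  peq_equiv : Equivalence peq }.

Declare Scope pset_scope.
Delimit Scope pset_scope with pset.
Notation "x ~~~ y" := (peq x y) (at level 70, no associativity) : pset_scope.
Local Open Scope pset_scope.

#[export] Existing Instance peq_equiv.

Record pmor (X Y : pset) := PMor {
  pfun :> X -> Y;
  pfunP : forall x x' : X, x ~~~ x' -> pfun x ~~~ pfun x' }.

Lemma pmor_ext (X Y : pset) (f g : pmor X Y) : f =1 g -> f = g.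
Proof.
case: f g => [f fP] [g gP] /= /funext fg; move: fP; rewrite fg => fP.
by congr PMor; exact: Prop_irrelevance.
Qed.

Definition pcomp (X Y Z : pset) (g : pmor Y Z) (f : pmor X Y) : pmor X Z :=
  PMor (fun x x' xx' => pfunP g (pfunP f xx')).

Definition pclass (X : pset) (x : X) : set X := [set x' | x ~~~ x'].

Definition is_pclass (X : pset) (C : set X) : Prop := exists x, C = pclass x.

Definition cofibration (X Y : pset) (f : pmor X Y) : Prop := injective f.

Definition fibration (X Y : pset) (f : pmor X Y) : Prop :=
  forall C : set X, is_pclass C -> is_pclass (f @` C).

(* The quotient set X/~, realized as the set of equivalence classes. *)
Definition pquot (X : pset) : Type := {C : set X | is_pclass C}.

Definition pproj (X : pset) (x : X) : pquot X :=
  exist _ (pclass x) (ex_intro _ x erefl).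

Lemma pquot_map_subproof (X Y : pset) (f : pmor X Y) (C : pquot X) :
  is_pclass [set y | exists2 x, sval C x & f x ~~~ y].
Proof.
case: C => C [x Cx] /=; rewrite {}Cx; exists (f x).
apply/seteqP; split=> y /=.
  by move=> [x' xx' fx'y]; rewrite /pclass /=; transitivity (f x') => //; exact: pfunP.
by move=> fxy; exists x => //; rewrite /pclass /=; reflexivity.
Qed.

(* A class C is sent to the class generated by its image; [pquot_mapE] shows
   that this is the map induced by f. *)
Definition pquot_map (X Y : pset) (f : pmor X Y) (C : pquot X) : pquot Y :=
  exist _ _ (pquot_map_subproof f C).

Lemma pquot_mapE (X Y : pset) (f : pmor X Y) (x : X) :
  pquot_map f (pproj x) = pproj (f x).
Proof.
apply: eq_exist; apply/seteqP; split=> y /=.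
  by move=> [x' xx' fx'y]; rewrite /pclass /=; transitivity (f x') => //;
     exact: pfunP.
by move=> fxy; exists x => //; rewrite /pclass /=; reflexivity.
Qed.

Definition acyclic (X Y : pset) (f : pmor X Y) : Prop :=
  bijective (pquot_map f).

Lemma phom_equiv (X Y : pset) :
  Equivalence (fun f g : pmor X Y => forall x, f x ~~~ g x).
Proof.
split.
- by move=> f x; reflexivity.
- by move=> f g fg x; symmetry.
- by move=> f g h fg gh x; transitivity (g x).
Qed.

Definition phom (X Y : pset) : pset := PSet (phom_equiv X Y).

Definition ppost (A X Y : pset) (p : pmor X Y) : pmor (phom A X) (phom A Y) :=
  @PMor (phom A X) (phom A Y) (fun f => pcomp p f)
    (fun f g fg a => pfunP p (fg a)).

Definition ppre (A B Y : pset) (j : pmor A B) : pmor (phom B Y) (phom A Y) :=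
  @PMor (phom B Y) (phom A Y) (fun f => pcomp f j) (fun f g fg a => fg (j a)).

Lemma pfibprod_equiv (U V W : pset) (f : pmor U W) (g : pmor V W) :
  Equivalence (fun w w' : {w : U * V | f w.1 = g w.2} =>
    (sval w).1 ~~~ (sval w').1 /\ (sval w).2 ~~~ (sval w').2).
Proof.
split.
- by move=> w; split; reflexivity.
- by move=> w w' [? ?]; split; symmetry.
- by move=> w w' w'' [? ?] [? ?]; split; [transitivity (sval w').1
                                         |transitivity (sval w').2].
Qed.

Definition pfibprod (U V W : pset) (f : pmor U W) (g : pmor V W) : pset :=
  PSet (pfibprod_equiv f g).

Section Pullback.
Variables (U V W : pset) (f : pmor U W) (g : pmor V W).

Definition pfst : pmor (pfibprod f g) U :=
  @PMor (pfibprod f g) U (fun w => (sval w).1) (fun _ _ => @proj1 _ _).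

Definition psnd : pmor (pfibprod f g) V :=
  @PMor (pfibprod f g) V (fun w => (sval w).2) (fun _ _ => @proj2 _ _).

Definition ppair (T : pset) (u : pmor T U) (v : pmor T V)
    (uv : pcomp f u = pcomp g v) : pmor T (pfibprod f g) :=
  @PMor T (pfibprod f g)
    (fun t => exist _ (u t, v t) (congr1 (fun h : pmor T W => h t) uv))
    (fun t t' tt' => conj (pfunP u tt') (pfunP v tt')).

Lemma pfibprod_comm : pcomp f pfst = pcomp g psnd.
Proof. by apply: pmor_ext => -[]. Qed.

Lemma pfibprod_universal (T : pset) (u : pmor T U) (v : pmor T V) :
  pcomp f u = pcomp g v ->
  exists! h : pmor T (pfibprod f g), pcomp pfst h = u /\ pcomp psnd h = v.
Proof.
move=> uv; exists (ppair uv); split; first by split; apply: pmor_ext.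
move=> h [hu hv]; apply: pmor_ext => t; rewrite /=.
apply: eq_sig_hprop => [?|/=]; first exact: Prop_irrelevance.
by rewrite [RHS]surjective_pairing -hu -hv.
Qed.

End Pullback.

Lemma ppost_ppre (A B X Y : pset) (j : pmor A B) (p : pmor X Y) :
  pcomp (ppost A p) (ppre X j) = pcomp (ppre Y j) (ppost B p).
Proof. by apply: pmor_ext => f; apply: pmor_ext. Qed.

(* The map f |-> (f \o j, p \o f). *)
Definition ppullback_hom (A B X Y : pset) (j : pmor A B) (p : pmor X Y) :
    pmor (phom B X) (pfibprod (ppost A p) (ppre Y j)) :=
  ppair (ppost_ppre j p).

(* Main.v *)
Require Import Defs.
From mathcomp Require Import all_boot.
From mathcomp Require Import boolp classical_sets.

(** A map is a fibration iff equivalences in the target lift along it to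
    equivalences with prescribed source, so a diagonal filler equivalent to a
    given map can be chosen pointwise: a function equivalent to a morphism is
    itself a morphism.  A map is acyclic iff it reflects equivalence and meets
    every class, so up to equivalence every morphism into [Y] lifts along an
    acyclic [p], and every morphism out of [A] extends along an acyclic [j]. *)

Local Open Scope pset_scope.

Lemma eq_pclass (X : pset) (x y : X) : pclass x = pclass y <-> x ~~~ y.
Proof.
split=> [xy|xy].
  by have : pclass y y by [rewrite /pclass /=; reflexivity]; rewrite -xy.
apply/seteqP; rewrite /pclass; split=> z /= h; last by transitivity y.
by transitivity x => //; symmetry.
Qed.

Lemma eq_pproj (X : pset) (x y : X) : pproj x = pproj y <-> x ~~~ y.
Proof.
rewrite -eq_pclass; split=> [/(congr1 sval)//|xy]; exact: eq_exist.
Qed.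

Lemma pproj_surj (X : pset) (C : pquot X) : exists x, C = pproj x.
Proof. by case: C => C [x Cx]; exists x; apply: eq_exist. Qed.

Lemma fibrationP (X Y : pset) (p : pmor X Y) :
  fibration p <->
  (forall x y, p x ~~~ y -> exists2 x', x ~~~ x' & p x' = y).
Proof.
split=> [fp x y pxy|lift C [x ->]].
  have [y0 e] := fp _ (ex_intro _ x erefl).
  (* The image class contains [p x], so it contains everything equivalent to [p x], in particular
     [y]. *)
  have y0px : pclass y0 (p x).
    by rewrite -e; exists x => //; rewrite /pclass /=; reflexivity.
  have : pclass y0 y by rewrite /pclass /=; transitivity (p x).
  by rewrite -e => -[x' xx' <-]; exists x'.
exists (p x); apply/seteqP; split=> y /=.
  by move=> [x' xx' <-]; exact: pfunP.
by move=> /lift[x' xx' <-]; exists x'.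
Qed.

Lemma acyclicP (X Y : pset) (f : pmor X Y) :
  acyclic f <->
  (forall x x', f x ~~~ f x' -> x ~~~ x') /\ (forall y, exists x, f x ~~~ y).
Proof.
split=> [[g fK gK]|[refl surj]].
  split=> [x x' ff|y].
    by apply/eq_pproj/(can_inj fK); rewrite !pquot_mapE; exact/eq_pproj.
  have [x gx] := pproj_surj _ (g (pproj y)).
  by exists x; apply/eq_pproj; rewrite -pquot_mapE -gx gK.
(* Choosing preimages gives a right inverse [g] of [pquot_map f]; injectivity then makes it
   two-sided. *)
have /choice[g gK] : forall D, exists C, pquot_map f C = D.
  move=> D; have [y ->] := pproj_surj _ D; have [x fx] := surj y.
  by exists (pproj x); rewrite pquot_mapE; exact/eq_pproj.
have finj : injective (pquot_map f).
  move=> C C'; have [x ->] := pproj_surj _ C; have [x' ->] := pproj_surj _ C'.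
  by rewrite !pquot_mapE => /eq_pproj/refl xx'; exact/eq_pproj.
by exists g => // C; apply: finj.
Qed.

Lemma pmor_of_equiv (X Y : pset) (f : pmor X Y) (g : X -> Y) :
  (forall x, f x ~~~ g x) -> forall x x', x ~~~ x' -> g x ~~~ g x'.
Proof.
move=> fg x x' xx'; transitivity (f x); first by symmetry.
by transitivity (f x') => //; exact: pfunP.
Qed.

(** Corrects a diagonal [f0] whose two triangles commute only up to equivalence to one that fills
    the square strictly. *)
Lemma fibration_filler (A B X Y : pset) (j : pmor A B) (p : pmor X Y)
    (f0 : pmor B X) (u : pmor A X) (v : pmor B Y) :
  cofibration j -> fibration p -> Defs.pcomp p u = Defs.pcomp v j ->
  (forall a, f0 (j a) ~~~ u a) -> (forall b, p (f0 b) ~~~ v b) ->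
  exists f : pmor B X,
    [/\ forall b, f0 b ~~~ f b, Defs.pcomp f j = u & Defs.pcomp p f = v].
Proof.
move=> jinj /fibrationP lift uv f0u f0v.
have uvE a : p (u a) = v (j a) by have := congr1 (fun h : pmor A Y => h a) uv.
(* On the image of [j] the value is forced to be [u a], unambiguous by injectivity; elsewhere [v b]
   is lifted along [p] starting from [f0 b]. *)
have /choice[f fP] : forall b, exists x,
    [/\ f0 b ~~~ x, p x = v b & forall a, j a = b -> x = u a].
  move=> b; have [[a <-]|nb] := pselect (exists a, j a = b).
    by exists (u a); split=> // a' /jinj ->.
  have [x f0x px] := lift _ _ (f0v b).
  by exists x; split=> // a ja; case: nb; exists a.
have f0f b : f0 b ~~~ f b by have [] := fP b.
exists (PMor (pmor_of_equiv _ _ f0 f f0f)); split=> //; apply: pmor_ext => z /=.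
  by have [_ _] := fP (j z); apply.
by have [] := fP z.
Qed.

Lemma acyclic_lift (B X Y : pset) (p : pmor X Y) (v : pmor B Y) :
  acyclic p -> exists f : pmor B X, forall b, p (f b) ~~~ v b.
Proof.
move=> /acyclicP[refl surj].
have /choice[f fP] b : exists x, p x ~~~ v b by exact: surj.
have fM b b' : b ~~~ b' -> f b ~~~ f b'.
  move=> bb'; apply: refl; transitivity (v b) => //.
  by transitivity (v b'); [exact: pfunP | symmetry].
by exists (PMor fM).
Qed.

Lemma acyclic_extension (A B X : pset) (j : pmor A B) (u : pmor A X) :
  acyclic j -> exists f : pmor B X, forall a, f (j a) ~~~ u a.
Proof.
move=> /acyclicP[refl surj].
(* [r] inverts [j] up to equivalence: [j (r b) ~~~ b], and reflection along [j] gives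
   [r (j a) ~~~ a]. The extension is [u] after [r]. *)
have /choice[r rP] := surj.
have rM b b' : b ~~~ b' -> u (r b) ~~~ u (r b').
  move=> bb'; apply/pfunP/refl; transitivity b => //.
  by transitivity b' => //; symmetry.
by exists (PMor rM) => a /=; exact/pfunP/refl.
Qed.

Theorem theorem6 (A B X Y : pset) (j : pmor A B) (p : pmor X Y) :
  cofibration j -> fibration p ->
  fibration (ppullback_hom j p) /\
  (acyclic j \/ acyclic p -> acyclic (ppullback_hom j p)).
Proof.
move=> jinj pfib; split.
  apply/fibrationP => f0 [[u v] /= uv] [/= f0u f0v].
  have [f [f0f fj pf]] := fibration_filler _ _ _ _ _ _ _ _ _ jinj pfib uv f0u f0v.
  exists f => //; apply: eq_sig_hprop => [?|/=]; first exact: Prop_irrelevance.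
  by rewrite fj pf.
move=> acyc; apply/acyclicP; split.
  move=> f g [/= fgj pfg] b.
  (* An acyclic [p] reflects [p (f b) ~~~ p (g b)]; for an acyclic [j], [b] is equivalent to some
     [j a], where [f] and [g] are equivalent. *)
  case: acyc => /acyclicP[refl surj]; last by apply: refl; exact: pfg.
  have [a jab] := surj b.
  transitivity (f (j a)); first by apply: pfunP; symmetry.
  by transitivity (g (j a)); [exact: fgj | exact: pfunP].
move=> [[u v] /= uv].
have uvE a : p (u a) = v (j a) by have := congr1 (fun h : pmor A Y => h a) uv.
(* Only the class of [(u, v)] must be hit: extending [u] or lifting [v] matches one component, and
   [uvE] together with acyclicity gives the other. *)
case: acyc => [jac|pac].
  have [f fj] := acyclic_extension _ _ _ _ u jac.
  exists f; split=> //= b; have /acyclicP[_ /(_ b)[a jab]] := jac.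
  transitivity (p (f (j a))); first by apply/pfunP/pfunP; symmetry.
  transitivity (p (u a)); first exact: pfunP.
  by rewrite uvE; exact: pfunP.
have [f pf] := acyclic_lift _ _ _ _ v pac.
exists f; split=> //= a; have /acyclicP[refl _] := pac.
by apply: refl; rewrite uvE; exact: pf.
Qed.
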